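(* Let $d \ge 1$, let $m_1,\ldots,m_d$ be odd positive integers, and let $G=\mathbb{Z}_{m_1}\times \cdots \times \mathbb{Z}_{m_d}$ (an abelian group of odd order). Then there exists a Slonimsky sequence in $G$ whose last term is $$\left(\frac{m_1-1}{2},\ldots, \frac{m_d-1}{2}\right).$$
   Context: $\mathbb{Z}_m=\mathbb{Z}/m\mathbb{Z}$ denotes the additive cyclic group of order $m$. Slonimsky sequence: let $G$ be a finite abelian group (written additively) of order $n$, and let $p_0,\ldots,p_{n-1}$ be a permutation of the elements of $G$ (each element listed exactly once) with $p_0=0$. Its sequence of signed differences is $h_0=0$ and $h_i=(-1)^{i-1}(p_{i-1}-p_i)$ for $1\le i<n$. The sequence $p_0,\ldots,p_{n-1}$ is a Slonimsky sequence if: (i) $h_i\ne h_j$ for all $0\le i<j<n$; (ii) $h_i+h_{n-i}=0$ for all $0<i<n$; (iii) $p_i+p_{n-i-1}=p_{n-1}$ for all $0\le i<n$. The element $p_{n-1}$ is called the last term of the sequence. *)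

(* Defs.v *)
From HB Require Import structures.
From mathcomp Require Import all_boot all_order all_algebra.

Set Implicit Arguments.
Unset Strict Implicit.
Unset Printing Implicit Defensive.

Import GRing.Theory.
Local Open Scope ring_scope.

Section DependentProduct.
Variables (I : finType) (V : I -> zmodType).
Implicit Types f g h : {dffun forall i, V i}.

Definition dffun_add f g : {dffun forall i, V i} := [ffun i => f i + g i].
Definition dffun_opp f : {dffun forall i, V i} := [ffun i => - f i].
Definition dffun_zero : {dffun forall i, V i} := [ffun i => 0].

Fact dffun_addA : associative dffun_add.
Proof. by move=> f g h; apply/ffunP=> i; rewrite !ffunE addrA. Qed.

Fact dffun_addC : commutative dffun_add.
Proof. by move=> f g; apply/ffunP=> i; rewrite !ffunE addrC. Qed.

Fact dffun_add0 : left_id dffun_zero dffun_add.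
Proof. by move=> f; apply/ffunP=> i; rewrite !ffunE add0r. Qed.

Fact dffun_addN : left_inverse dffun_zero dffun_opp dffun_add.
Proof. by move=> f; apply/ffunP=> i; rewrite !ffunE addNr. Qed.

HB.instance Definition _ := GRing.isZmodule.Build {dffun forall i, V i}
  dffun_addA dffun_addC dffun_add0 dffun_addN.

End DependentProduct.

HB.instance Definition _ (I : finType) (V : I -> finZmodType) :=
  GRing.Zmodule.on {dffun forall i, V i}.

(* The additive group of integers modulo m, for m > 0. The library's ['Z_m]
   cannot be used here because it denotes Z/2Z when m = 1; ['I_k.+1] carries
   addition modulo k.+1 for every k, and m.-1.+1 = m as soon as m > 0. *)
Definition cyc (m : nat) : finZmodType := 'I_m.-1.+1.

Definition cyc_prod (d : nat) (m : 'I_d -> nat) : finZmodType :=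
  {dffun forall i : 'I_d, cyc (m i)}.

Section Slonimsky.
Variable G : finZmodType.
Implicit Type p : seq G.

Definition signed_diff p (i : nat) : G :=
  if i is j.+1 then (p`_j - p`_j.+1) *~ (-1) ^+ j else 0.

Definition slonimsky p : Prop :=
  let n := #|G| in
  let h := signed_diff p in
  [/\ perm_eq p (enum G) /\ p`_0 = 0,
      forall i j : nat, (i < j < n)%N -> h i <> h j,
      forall i : nat, (0 < i < n)%N -> h i + h (n - i)%N = 0
    & forall i : nat, (i < n)%N -> p`_i + p`_(n - i - 1) = p`_(n - 1)].

Definition last_term p : G := p`_(#|G| - 1).

End Slonimsky.

Definition half_point (d : nat) (m : 'I_d -> nat) : cyc_prod m :=
  [ffun i : 'I_d => (inZp ((m i - 1) %/ 2) : cyc (m i))].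

(* Main.v *)
(* Induction on the number of cyclic factors. Let p_0, ..., p_(a-1) be a
   Slonimsky sequence in A with last term l, and let c be an element of odd
   order m in a direct complement of A. Run m times through p, alternately
   forwards and backwards: by (iii) a backward run lists the elements l - p_i.
   At time t = a * k + i (that is, in run k) add -k c if t is even and (k+1) c
   if t is odd. The signed difference at time t is then h_i - (2 k + [i != 0]) c,
   where h_0 = 0. As m is odd these are distinct, and so are the terms: equal
   terms at times of opposite parity would be in runs k, k' with
   k + k' + 1 = m, hence in runs of the same parity, so at the same i. The last
   term is l + c. For Z_M take c = (M - 1) / 2, a generator since 2 c = -1.
   Condition (ii) follows from (iii) when the order of the group is odd. *)
From HB Require Import structures.
Require Import Defs.
From mathcomp Require Import all_boot all_order all_algebra.
From mathcomp Require Import zify.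

Set Implicit Arguments.
Unset Strict Implicit.
Unset Printing Implicit Defensive.

Import GRing.Theory.
Local Open Scope ring_scope.

(** * Signs, reversal of indices, and cancellation modulo an integer *)

Lemma mulrz_sign (V : zmodType) (x : V) j :
  x *~ (-1) ^+ j = if odd j then - x else x.
Proof. by rewrite -signr_odd; case: odd; rewrite ?expr1 ?mulrN1z ?expr0 ?mulr1z. Qed.

(** For odd [n] the indices [i] and [n - i] have opposite parity, hence opposite signs, and symmetry
    gives [p_(i-1) + p_(n-i) = p_i + p_(n-i-1)]. *)
Lemma signed_diff_antisym (G : finZmodType) (p : seq G) n :
  odd n -> (forall i, (i < n)%N -> p`_i + p`_(n - i - 1) = p`_(n - 1)) ->
  forall i, (0 < i < n)%N -> signed_diff p i + signed_diff p (n - i) = 0.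
Proof.
move=> oddG sym [//|i] /= ltiG.
have -> : (n - i.+1 = (n - i - 2).+1)%N by lia.
have -> /= : signed_diff p (n - i - 2).+1
  = (p`_(n - i.+1 - 1) - p`_(n - i - 1)) *~ (-1) ^+ i.+1.
  rewrite /= !mulrz_sign (_ : odd (n - i - 2) = odd i.+1); last by lia.
  by congr (if _ then - (p`_ _ - p`_ _) else p`_ _ - p`_ _); lia.
rewrite exprS mulN1r mulrNz -mulrzBl.
have eq_sum : p`_i + p`_(n - i - 1) = p`_(n - i.+1 - 1) + p`_i.+1.
  by rewrite [RHS]addrC sym ?(ltnW ltiG) // -(sym i.+1) // -subnDA addn1.
rewrite -[p`_i](addrK p`_(n - i - 1)) eq_sum.
by rewrite (addrAC _ (- p`_(n - i - 1))) addrK subrr mul0rz.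
Qed.

(** Time reversal reverses both the run and the position within the run; this serves condition
    (iii). *)
Lemma divn_modn_rev a m t : (t < a * m)%N ->
  ((a * m - t - 1) %/ a = m - t %/ a - 1)%N /\
  ((a * m - t - 1) %% a = a - t %% a - 1)%N.
Proof.
case: (posnP a) => [->|a_gt0 ltt]; first by rewrite mul0n.
have ltk : (t %/ a < m)%N by rewrite ltn_divLR // mulnC.
have lti := ltn_pmod t a_gt0.
have -> : (a * m - t - 1 = (m - t %/ a - 1) * a + (a - t %% a - 1))%N.
  rewrite {1}(divn_eq t a); move: ltk lti; move: (t %/ a)%N (t %% a)%N => k i.
  move=> ltk lti; have -> : m = (k + (m - k - 1).+1)%N by lia.
  by move: (m - k - 1)%N => r; rewrite (_ : k + _ - k - 1 = r)%N; lia.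
have small : (a - t %% a - 1 < a)%N by lia.
by rewrite divnMDl // modnMDl (divn_small small) (modn_small small) addn0.
Qed.

Lemma eqn_modMr_coprime h d i j : coprime d h ->
  (i * h == j * h %[mod d])%N = (i == j %[mod d])%N.
Proof.
move=> co_dh; case/orP: (leq_total i j) => [le|le].
  rewrite eq_sym [RHS]eq_sym.
all: by rewrite !eqn_mod_dvd ?leq_mul2r ?le ?orbT // -mulnBl Gauss_dvdl.
Qed.

(** * Extending a Slonimsky sequence by a cyclic direct factor *)

Section Extension.

Variables (A G : finZmodType) (f : {additive A -> G}) (c : G) (a m : nat).
Hypotheses (odda : odd a) (oddm : odd m) (cardA : #|A| = a) (cardG : #|G| = (a * m)%N).
(** Together these say that [f] is injective, that [c] has order exactly [m], and that the multiples
    of [c] meet the image of [f] only in 0. *)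
Hypothesis cm0 : c *+ m = 0.
Hypothesis fc_direct : forall x y k l,
  f x + c *+ k = f y + c *+ l -> x = y /\ k = l %[mod m].

Variable p : seq A.
Hypothesis slonp : slonimsky p.

Let n := (a * m)%N.
Let l := last_term p.

Let p0 : p`_0 = 0. Proof. by case: slonp => -[]. Qed.

Let p_sym i : (i < a)%N -> p`_i + p`_(a - i - 1) = l.
Proof. by case: slonp; rewrite /l /last_term cardA => _ _ _; apply. Qed.

Let p_inj i j : (i < a)%N -> (j < a)%N -> p`_i = p`_j -> i = j.
Proof.
case: slonp => -[/[dup] /perm_size szp /perm_uniq up _] _ _ _.
move: szp; rewrite -cardE cardA => szp lti ltj /eqP.
by rewrite nth_uniq ?szp ?up ?enum_uniq // => /eqP.
Qed.

Let h_inj i j : (i < a)%N -> (j < a)%N ->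
  signed_diff p i = signed_diff p j -> i = j.
Proof.
case: slonp; rewrite cardA => _ h_neq _ _ lti ltj eqh.
case: (ltngtP i j) => // ltij.
  by case: (h_neq i j); rewrite ?ltij.
by case: (h_neq j i); rewrite ?ltij.
Qed.

Let a_gt0 : (0 < a)%N. Proof. exact: odd_gt0. Qed.

Definition fold_part t : A :=
  if odd (t %/ a) then l - p`_(t %% a) else p`_(t %% a).

Definition zigzag_part t : G :=
  if odd t then c *+ (t %/ a).+1 else - (c *+ (t %/ a)).

Definition extension : seq G :=
  mkseq (fun t => f (fold_part t) + zigzag_part t) n.

Let nth_ext t : (t < n)%N -> extension`_t = f (fold_part t) + zigzag_part t.
Proof. by move=> ltt; rewrite nth_mkseq. Qed.

Let odd_div_mod t : odd t = odd (t %/ a) (+) odd (t %% a).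
Proof. by rewrite {1}(divn_eq t a) oddD oddM odda andbT. Qed.

Let div_ltm t : (t < n)%N -> (t %/ a < m)%N.
Proof. by rewrite /n mulnC ltn_divLR. Qed.

Let fold_inj s t : odd (s %/ a) = odd (t %/ a) ->
  fold_part s = fold_part t -> s = t %[mod a].
Proof.
rewrite /fold_part => ->; case: odd => [/addrI/oppr_inj|];
  exact/p_inj/ltn_pmod/a_gt0/ltn_pmod.
Qed.

Let ext_inj s t : (s < n)%N -> (t < n)%N ->
  extension`_s = extension`_t -> s = t.
Proof.
move=> lts ltt; rewrite !nth_ext // => eq_ext.
have ltsm := div_ltm lts; have lttm := div_ltm ltt.
have same_div : (s %/ a = t %/ a)%N -> fold_part s = fold_part t -> s = t.
  move=> eqd eqf; rewrite (divn_eq s a) (divn_eq t a) eqd.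
  by congr (_ + _)%N; apply: fold_inj; rewrite ?eqd.
have opposite s' t' : (s' < n)%N -> (t' < n)%N -> odd s' -> ~~ odd t' ->
  f (fold_part s') + zigzag_part s' = f (fold_part t') + zigzag_part t' -> False.
  move=> lts' ltt' os et; rewrite /zigzag_part os (negPf et) => /eqP.
  rewrite eq_sym subr_eq eq_sym -addrA -mulrnDr -[f (fold_part t')]addr0.
  rewrite -(mulr0n c) => /eqP/fc_direct[eqf]; rewrite mod0n => /eqP.
  (* The two run numbers, both below [m], satisfy [0 < k + k' + 1 < 2 m], so this multiple of [m] is
     [m] itself. *)
  rewrite -/(dvdn _ _) => /dvdnP[[|[|q]]]; first by rewrite mul0n.
    rewrite mul1n => eqm.
    have od : odd (s' %/ a) = odd (t' %/ a).
      by move: oddm; rewrite -eqm oddD /=; do 2!case: odd.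
    move: os et; rewrite (odd_div_mod s') (odd_div_mod t') od.
    by rewrite (fold_inj od eqf) => ->.
  move=> eqm; have := leq_add (div_ltm lts') (div_ltm ltt').
  by rewrite addnS eqm !mulSn addnA ltnNge leq_addr.
case os: (odd s); case ot: (odd t).
- move: eq_ext; rewrite /zigzag_part os ot => /fc_direct[eqf].
  move=> /eqP; rewrite (eqn_modDl 1) !modn_small // => /eqP eqd.
  exact: same_div.
- by case: (opposite s t); rewrite ?os ?ot.
- by case: (opposite t s); rewrite ?os ?ot.
move: eq_ext; rewrite /zigzag_part os ot => /eqP.
rewrite subr_eq addrAC eq_sym subr_eq => /eqP/fc_direct[eqf].
by rewrite !modn_small // => eqd; apply: same_div.
Qed.

(** Within a run, the reflection [x -> l - x] of odd runs negates differences, and since [a] is odd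
    this is also the ratio of the signs at [t] and at [t %% a]. Across a junction the term repeats
    ([l] or 0), which gives [h_0 = 0]. *)
Let diff_fold t : fold_part t - fold_part t.+1 =
  signed_diff p (t.+1 %% a) *~ (-1) ^+ t.
Proof.
rewrite /fold_part modnS divnS //; case: (boolP (a %| t.+1)%N) => dva.
  (* The form [a - 0 - 1] lets [p_sym] at 0 identify the last term of [p] as [l]. *)
  have -> : (t %% a = a - 0 - 1)%N.
    have /dvdnP[[|q]] := dva; rewrite ?mul0n // mulSn => eqt.
    have -> : (t = q * a + (a - 0 - 1))%N by lia.
    by rewrite modnMDl modn_small //; lia.
  rewrite oddD /= p0 subr0 mul0rz.
  have := p_sym a_gt0; rewrite p0 add0r => ->.
  by case: odd; rewrite ?subrr.
rewrite add0n /= !mulrz_sign (odd_div_mod t).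
have reflect x y : l - x - (l - y) = - (x - y) :> A.
  by rewrite !opprB addrC addrA subrK.
by do 2![case: odd => /=]; rewrite ?reflect ?opprK.
Qed.

(** For either parity of [t] the coefficient is [k + k' + 1], where [k] and [k'] are the runs of [t]
    and [t.+1]; here [k = k'] unless [t.+1] opens a new run. *)
Let diff_zigzag t : (zigzag_part t - zigzag_part t.+1) *~ (-1) ^+ t =
  - (c *+ ((t.+1 %/ a).*2 + (t.+1 %% a != 0)%N)).
Proof.
have -> : ((t.+1 %/ a).*2 + (t.+1 %% a != 0) = t %/ a + (t.+1 %/ a).+1)%N.
  by rewrite divnS // modnS; case: (a %| t.+1)%N => /=; lia.
rewrite /zigzag_part mulrz_sign /=; case: odd => /=.
  by rewrite opprK -mulrnDr; congr (- (c *+ _)); lia.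
by rewrite -opprD -mulrnDr.
Qed.

Let signed_diff_ext t : (t < n)%N -> signed_diff extension t =
  f (signed_diff p (t %% a)) - c *+ ((t %/ a).*2 + (t %% a != 0)%N).
Proof.
case: t => [|t] ltt; first by rewrite mod0n div0n /= raddf0 subr0.
rewrite [LHS]/= !nth_ext ?(ltnW ltt) // opprD addrACA -raddfB mulrzDl.
rewrite diff_zigzag diff_fold -raddfMz; congr (f _ + _).
by rewrite -mulrzA -expr2 sqrr_sign mulr1z.
Qed.

Let ext_diff_inj s t : (s < n)%N -> (t < n)%N ->
  signed_diff extension s = signed_diff extension t -> s = t.
Proof.
move=> lts ltt; rewrite !signed_diff_ext // => /eqP.
rewrite subr_eq addrAC eq_sym subr_eq => /eqP/fc_direct[].
move/h_inj => /(_ (ltn_pmod _ a_gt0) (ltn_pmod _ a_gt0)) eqi.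
(* Equal positions have equal corrections, and doubling is injective modulo the odd [m]. *)
rewrite eqi => /eqP; rewrite eqn_modDr -!muln2.
rewrite eqn_modMr_coprime ?coprimen2 // !modn_small ?div_ltm // => /eqP eqd.
by rewrite (divn_eq s a) (divn_eq t a) eqi eqd.
Qed.

Let ext_sum t : (t < n)%N ->
  extension`_t + extension`_(n - t - 1) = f l + c.
Proof.
move=> ltt; have ltm := div_ltm ltt; have lta := ltn_pmod t a_gt0.
have [divs mods] := divn_modn_rev ltt; rewrite -/n in divs mods.
rewrite !nth_ext; [|lia|lia]; rewrite addrACA -raddfD; congr (f _ + _).
  rewrite /fold_part divs mods (_ : odd (m - _ - 1)%N = odd (t %/ a)); last by lia.
  case: odd; last exact: p_sym.
  by rewrite addrACA -opprD p_sym // addrK.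
(* As [n] is odd, both times have the same parity. Their runs are [k] and [m - k - 1], so the
   coefficients add up to [m + 1] or [-(m - 1)], both 1 modulo [m]. *)
rewrite /zigzag_part divs (_ : odd (_ - t - 1)%N = odd t).
  case: odd; first by rewrite -mulrnDr (_ : _ + _ = m.+1)%N ?mulrS ?cm0 ?addr0 //; lia.
  rewrite -opprD -mulrnDr (_ : _ + _ = m.-1)%N; last by lia.
  apply/eqP; rewrite eq_sym -subr_eq0 opprK -mulrS prednK ?cm0 //; lia.
have : odd n by rewrite /n oddM odda.
by lia.
Qed.

Lemma slonimsky_extension : slonimsky extension /\ last_term extension = f l + c.
Proof.
have oddn : odd n by rewrite /n oddM odda.
have n_gt0 := odd_gt0 oddn.
have ext0 : extension`_0 = 0.
  by rewrite nth_ext // /fold_part /zigzag_part div0n mod0n /= p0 raddf0 subr0.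
have last_ext : last_term extension = f l + c.
  by have := ext_sum n_gt0; rewrite ext0 add0r subn0 /last_term cardG.
have sym i : (i < n)%N ->
    extension`_i + extension`_(n - i - 1) = extension`_(n - 1).
  by move=> lti; rewrite ext_sum // -last_ext /last_term cardG.
split=> //; split; rewrite ?cardG -/n //.
- split=> //; have szext : size extension = n by rewrite size_mkseq.
  have uext : uniq extension.
    by apply/(uniqP 0) => i j; rewrite !inE szext; apply: ext_inj.
  apply: uniq_perm (enum_uniq _) _ => // x; rewrite mem_enum inE.
  have /subset_cardP : #|extension| = #|G| by rewrite (card_uniqP uext) szext cardG.
  by move=> /(_ (subset_predT _)) ->.
- move=> i j /andP[ltij ltj] /ext_diff_inj eqij.
  by have := ltij; rewrite eqij ?ltnn // (ltn_trans ltij).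
- exact: signed_diff_antisym.
Qed.

End Extension.

(** * Splitting off the first cyclic factor, and the induction *)

Lemma card_cyc_prod (d : nat) (m : 'I_d -> nat) :
  (forall i, odd (m i)) -> #|cyc_prod m| = (\prod_i m i)%N.
Proof.
move=> oddm; rewrite card_dep_ffun foldrE big_image /=.
by apply: eq_bigr => i _; rewrite card_ord prednK ?odd_gt0.
Qed.

Section CyclicProductStep.

Variables (d : nat) (m : 'I_d.+1 -> nat).
Hypothesis oddm : forall i, odd (m i).

Let tail_mod (j : 'I_d) := m (lift ord0 j).

(* Going through [nat] avoids a dependent cast along [lift ord0 j = i]. *)
Definition tail_embed (x : cyc_prod tail_mod) : cyc_prod m :=
  [ffun i => inZp (if unlift ord0 i is Some j then val (x j) else 0%N)].

(** This is the element [c] of the extension; it is the difference between the half point and the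
    embedded half point of the tail. *)
Definition half_head : cyc_prod m :=
  [ffun i => inZp (if unlift ord0 i is Some _ then 0%N else (m i - 1) %/ 2)].

Let tail_embed_lift x j : tail_embed x (lift ord0 j) = x j.
Proof. by rewrite ffunE liftK valZpK. Qed.

Let tail_embed_ord0 x : tail_embed x ord0 = 0.
Proof. by rewrite ffunE unlift_none; apply/val_inj; rewrite /= mod0n. Qed.

Fact tail_embed_is_zmod_morphism : zmod_morphism tail_embed.
Proof.
move=> x y; apply/ffunP=> i; rewrite [RHS]ffunE [X in _ = _ + X]ffunE.
case: (unliftP ord0 i) => [j|] ->; last by rewrite !tail_embed_ord0 subr0.
by rewrite !tail_embed_lift !ffunE.
Qed.

HB.instance Definition _ :=
  GRing.isZmodMorphism.Build (cyc_prod tail_mod) (cyc_prod m) tail_embed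
    tail_embed_is_zmod_morphism.

Let half_head_muln_lift k j : (half_head *+ k) (lift ord0 j) = 0.
Proof.
elim: k => [|k IHk]; first by rewrite mulr0n ffunE.
rewrite mulrS ffunE IHk addr0 ffunE liftK.
by apply/val_inj; rewrite /= mod0n.
Qed.

Let half_head_muln_ord0 k :
  (half_head *+ k) ord0 = inZp ((m ord0 - 1) %/ 2 * k).
Proof.
elim: k => [|k IHk].
  by rewrite mulr0n ffunE muln0; apply/val_inj; rewrite /= mod0n.
rewrite mulrS ffunE IHk ffunE unlift_none mulnS.
by apply/val_inj; rewrite /= modnDm.
Qed.

Let half_head_muln_modulus : half_head *+ m ord0 = 0.
Proof.
apply/ffunP=> i; rewrite [RHS]ffunE.
case: (unliftP ord0 i) => [j|] ->; first exact: half_head_muln_lift.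
rewrite half_head_muln_ord0; apply/val_inj.
by rewrite /= prednK ?odd_gt0 // modnMl.
Qed.

(** The later coordinates recover [x]; the first recovers [k] modulo [m ord0] because
    [(m ord0 - 1) / 2] is a unit there. *)
Let tail_half_direct x y k l :
  tail_embed x + half_head *+ k = tail_embed y + half_head *+ l ->
  x = y /\ k = l %[mod m ord0].
Proof.
move=> /ffunP eqxy; split.
  apply/ffunP=> j; have := eqxy (lift ord0 j).
  rewrite ![(_ + _ : cyc_prod m) _]ffunE !half_head_muln_lift !addr0.
  by rewrite !tail_embed_lift.
have := eqxy ord0.
rewrite ![(_ + _ : cyc_prod m) _]ffunE !half_head_muln_ord0 !tail_embed_ord0 !add0r.
move=> /(congr1 val); rewrite /= prednK ?odd_gt0 //.
move/eqP; rewrite ![(_ %/ 2 * _)%N]mulnC eqn_modMr_coprime => [/eqP //|].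
(* With [m ord0 = 2 h + 1] the multiplier is [h], and [gcd(h, 2 h + 1) = 1]. *)
have [h ->] : exists h, m ord0 = (h * 2).+1.
  by exists (m ord0)./2; have := oddm ord0; lia.
by rewrite subn1 mulnK // coprime_sym /coprime -addn1 mulnC gcdnMDl gcdn1.
Qed.

Lemma slonimsky_cyc_prod_step p :
  @slonimsky (cyc_prod tail_mod) p -> last_term p = half_point tail_mod ->
  exists q : seq (cyc_prod m), slonimsky q /\ last_term q = half_point m.
Proof.
move=> slonp lastp.
have cardG : #|cyc_prod m| = (#|cyc_prod tail_mod| * m ord0)%N.
  have oddm_tail j : odd (tail_mod j) by apply: oddm.
  by rewrite !card_cyc_prod // big_ord_recl mulnC.
have oddA : odd #|cyc_prod tail_mod|.
  rewrite card_cyc_prod => [|j]; last exact: oddm.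
  by elim/big_ind: _ => [//|x y ox oy|j _]; [rewrite oddM ox | exact: oddm].
have [slonq lastq] := slonimsky_extension oddA (oddm ord0) erefl cardG
  half_head_muln_modulus tail_half_direct slonp.
eexists; split; [exact: slonq | rewrite lastq lastp].
apply/ffunP=> i; rewrite [LHS]ffunE.
case: (unliftP ord0 i) => [j|] ->.
  by rewrite tail_embed_lift -[half_head]mulr1n half_head_muln_lift addr0 !ffunE.
by rewrite tail_embed_ord0 add0r !ffunE unlift_none.
Qed.

End CyclicProductStep.

Lemma slonimsky_cyc_prod0 (m : 'I_0 -> nat) :
  @slonimsky (cyc_prod m) [:: 0] /\ last_term [:: 0] = half_point m.
Proof.
have eq_cyc_prod0 (x y : cyc_prod m) : x = y by apply/ffunP; case.
have card1 : #|cyc_prod m| = 1%N by rewrite card_cyc_prod ?big_ord0 //; case.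
split; last exact: eq_cyc_prod0.
split=> [|i j|i|i]; rewrite ?card1.
- split=> //; apply: uniq_perm; rewrite ?enum_uniq // => x.
  by rewrite mem_enum (eq_cyc_prod0 x 0) inE eqxx.
- by lia.
- by lia.
- by move=> _; apply: eq_cyc_prod0.
Qed.

Local Close Scope ring_scope.

Theorem theorem5 (d : nat) (m : 'I_d -> nat)
    (hd : 1 <= d) (hm : forall i : 'I_d, odd (m i)) :
  exists p : seq (cyc_prod m), slonimsky p /\ last_term p = half_point m.
Proof.
clear hd.
elim: d m hm => [|d IHd] m oddm.
  by exists [:: 0%R]; apply: slonimsky_cyc_prod0.
have [p [slonp lastp]] := IHd _ (fun j => oddm (lift ord0 j)).
exact: slonimsky_cyc_prod_step slonp lastp.
Qed.
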